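(* For $n\ge 1$, \begin{align*} A_n(p,q,t)&=\sum_{k=0}^{\lfloor{(n-1)/2\rfloor}}\gamma_{n,k}(p,q)\,t^{k}(1+t)^{n-1-2k}\\ &=\sum_{k=0}^{\lfloor{(n-1)/2\rfloor}}(p+q)^k\,\mathrm{d}_{n, k}(p,q)\,t^{k}(1+t)^{n-1-2k}. \end{align*}
   Context: For a permutation $\sigma=\sigma_1\ldots\sigma_n$ of $[n]$: $\operatorname{des}\sigma$ is the number of $i<n$ with $\sigma_i>\sigma_{i+1}$; $\operatorname{les}\sigma$ is the number of pairs $(i,j)$ with $2\le i<j\le n$ and $\sigma_{i-1}>\sigma_j>\sigma_i$; $\operatorname{res}\sigma$ is the number of pairs $(i,j)$ with $1\le i<j\le n-1$ and $\sigma_{j+1}>\sigma_i>\sigma_j$. With the convention $\sigma_0=\sigma_{n+1}=0$, an entry $\sigma_i$ is a valley if $\sigma_{i-1}>\sigma_i<\sigma_{i+1}$ and a double descent if $\sigma_{i-1}>\sigma_i>\sigma_{i+1}$. Let $\mathcal{G}_{n,k}$ be the set of permutations of $[n]$ with exactly $k$ valleys and no double descents. For $\sigma$ a permutation of $[n]$, $\sigma_{[k]}$ denotes the subword of $\sigma$ formed by the letters $1,\dots,k$ in the order they appear; $\sigma$ is an André permutation if, for every $1\le k\le n$, $\sigma_{[k]}$ has no double descents and ends with an ascent. Let $\mathfrak{D}_{n,k}$ be the set of André permutations of $[n]$ with $k$ descents. Define $A_n(p,q,t)=\sum_{\sigma\in\mathfrak{S}_n}p^{\operatorname{res}\sigma}q^{\operatorname{les}\sigma}t^{\operatorname{des}\sigma}$,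 $\gamma_{n,k}(p,q)=\sum_{\sigma\in\mathcal{G}_{n,k}}p^{\operatorname{res}\sigma}q^{\operatorname{les}\sigma}$, $\mathrm{d}_{n,k}(p,q)=\sum_{\sigma\in\mathfrak{D}_{n,k}}p^{\operatorname{res}\sigma}q^{\operatorname{les}\sigma-k}$. *)

(* Defs.v *)
From HB Require Import structures.
From mathcomp Require Export all_boot all_order fingroup perm all_algebra.

Set Implicit Arguments.
Unset Strict Implicit.
Unset Printing Implicit Defensive.

Import GRing.Theory.

(* Permutations of [n] are 'S_n, acting on {0, ..., n-1}; [word] shifts the
   values back to {1, ..., n}, so that 0 is free for the boundary convention. *)
Definition word (n : nat) (s : 'S_n) : seq nat :=
  [seq (s i).+1 | i <- enum 'I_n].

(* w_i with 1-based positions and w_0 = w_(size w + 1) = 0: index 0 hits the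
   prepended 0 and index size w + 1 the default value of nth. *)
Definition letter (w : seq nat) (i : nat) : nat := nth 0 (0 :: w) i.

Definition des (w : seq nat) : nat :=
  \sum_(1 <= i < size w) (letter w i > letter w i.+1).

Definition les (w : seq nat) : nat :=
  \sum_(2 <= i < (size w).+1) \sum_(i.+1 <= j < (size w).+1)
    ((letter w i.-1 > letter w j) && (letter w j > letter w i)).

Definition res (w : seq nat) : nat :=
  \sum_(1 <= j < size w) \sum_(1 <= i < j)
    ((letter w j.+1 > letter w i) && (letter w i > letter w j)).

Definition is_valley (w : seq nat) (i : nat) : bool :=
  (letter w i.-1 > letter w i) && (letter w i < letter w i.+1).

Definition is_double_descent (w : seq nat) (i : nat) : bool :=
  (letter w i.-1 > letter w i) && (letter w i > letter w i.+1).

Definition valleys (w : seq nat) : nat :=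
  \sum_(1 <= i < (size w).+1) is_valley w i.

Definition no_double_descent (w : seq nat) : bool :=
  all (fun i => ~~ is_double_descent w i) (iota 1 (size w)).

(* A one-letter word w_1 > 0 ends with an ascent, since w_0 = 0. *)
Definition ends_with_ascent (w : seq nat) : bool :=
  letter w (size w).-1 < letter w (size w).

Definition subword (w : seq nat) (k : nat) : seq nat :=
  [seq a <- w | 1 <= a <= k].

Definition is_andre (w : seq nat) : bool :=
  all (fun k => no_double_descent (subword w k) && ends_with_ascent (subword w k))
    (iota 1 (size w)).

Definition Gset (n k : nat) : {set 'S_n} :=
  [set s : 'S_n | (valleys (word s) == k) && no_double_descent (word s)].

Definition Dset (n k : nat) : {set 'S_n} :=
  [set s : 'S_n | is_andre (word s) && (des (word s) == k)].

Local Open Scope ring_scope.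

(* The polynomials are given by their values at arbitrary p, q, t in an
   arbitrary commutative ring; indeterminates over int are one instance. *)

Definition Apoly (R : comNzRingType) (n : nat) (p q t : R) : R :=
  \sum_(s : 'S_n) p ^+ res (word s) * q ^+ les (word s) * t ^+ des (word s).

Definition gamma (R : comNzRingType) (n k : nat) (p q : R) : R :=
  \sum_(s in Gset n k) p ^+ res (word s) * q ^+ les (word s).

(* The subtraction in the exponent never truncates: if w_(i-1) > w_i is a
   descent of an Andre permutation w, then in the subword of letters
   <= w_(i-1) the letter w_i is followed by a larger one, which forms with
   this descent a pair counted by les; hence les w >= des w. *)
Definition dpoly (R : comNzRingType) (n k : nat) (p q : R) : R :=
  \sum_(s in Dset n k) p ^+ res (word s) * q ^+ (les (word s) - k).

(* Main.v *)
From mathcomp Require Import zify ring.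
Require Import Defs.

(** A permutation is built by inserting 1, 2, ..., n in this order.  Before the
    letter x is inserted, the smaller letters form blocks separated by m gaps,
    the maximal runs of letters still to come.  Putting x into the g-th gap adds
    g - 1 to [les] and m - g to [res]; according to whether x leaves a gap on its
    left and on its right, it becomes a valley (m grows by 1), a double descent
    or a double ascent (m is kept), or a peak (m drops by 1).  Hence A_n counts
    Motzkin paths with weight t [m] for up steps, (1 + t) [m] for level steps
    and [m] for down steps, and merging the two kinds of level steps gives the
    expansion in gamma_{n,k}.

    For Andre permutations the left gap created by a valley is locked until its
    right gap, the next one, receives a letter.  If these are the gaps i and
    i + 1, the weight of the latter, freed of one factor q and multiplied by
    p + q, is q^(i-1) p^(m-i-1) (p + q), which is the sum of the weights of both
    gaps; so the locks cost exactly one factor p + q per valley. *)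

Set Implicit Arguments.
Unset Strict Implicit.
Unset Printing Implicit Defensive.

Import GRing.Theory.

(** * Statistics by recursion on words *)

(* [F] receives the comparisons of each letter with its two neighbours; [x] and
   [e] are the letters before and after [l]. *)
Fixpoint tripsum (F : bool -> bool -> bool -> bool) (e x : nat) (l : seq nat) :=
  if l is c :: l' then
    F (c < x) (c < head e l') (head e l' < c) + tripsum F e c l'
  else 0.

(** A descent is charged to its lower letter, so only the comparison with the left neighbour
    counts. *)
Definition desF (a b c : bool) := a.
Definition valF (a b c : bool) := a && b.
Definition ddF (a b c : bool) := a && c.
Definition daF (a b c : bool) := ~~ a && b.

Fixpoint crossings (c x : nat) (l : seq nat) :=
  if l is d :: l' then ((c < x) && (d < c)) + crossings c d l' else 0.

(** [les] grouped by its index [j]: each letter is charged with the descents before it that straddle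
    its value. In this form the statistic splits over concatenation. *)
Fixpoint les_from (pre w : seq nat) :=
  if w is c :: w' then crossings c 0 pre + les_from (rcons pre c) w' else 0.

Lemma tripsum_cat F e x u w :
  tripsum F e x (u ++ w) = tripsum F (head e w) x u + tripsum F e (last x u) w.
Proof.
elim: u x => [|c u IH] x //=; rewrite IH addnA.
by case: u {IH}.
Qed.

Lemma crossings_cat c x u w :
  crossings c x (u ++ w) = crossings c x u + crossings c (last x u) w.
Proof. by elim: u x => [|d u IH] x //=; rewrite IH addnA. Qed.

Lemma les_from_cat pre u w :
  les_from pre (u ++ w) = les_from pre u + les_from (pre ++ u) w.
Proof.
elim: u pre => [|c u IH] pre /=; first by rewrite cats0.
by rewrite IH cat_rcons addnA.
Qed.

Lemma letter_rcons w c i :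
  letter (rcons w c) i = if i == (size w).+1 then c else letter w i.
Proof.
case: i => [|i] //; rewrite /letter /= nth_rcons eqSS.
case: ltngtP => // h.
by rewrite nth_default // ltnW.
Qed.

Lemma letter_size w : letter w (size w) = last 0 w.
Proof. exact: (nth_last 0 (0 :: w)). Qed.

(** Appending a letter changes the right neighbour of the former last letter; hence the induction
    needs an arbitrary closing letter [e]. *)
Lemma tripsum_letterE (F : bool -> bool -> bool -> bool) e w :
  \sum_(1 <= i < (size w).+1)
     F (letter w i < letter w i.-1)
       (letter w i < (if i == size w then e else letter w i.+1))
       ((if i == size w then e else letter w i.+1) < letter w i)
  = tripsum F e 0 w.
Proof.
elim/last_ind: w e => [|w c IH] e; first by rewrite big_geq.
rewrite size_rcons big_nat_recr //= -cats1 tripsum_cat /= -IH; congr addn.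
  apply: eq_big_nat => i /andP[i1 i2].
  have i3 : (i == (size w).+1) = false by lia.
  have i4 : (i.-1 == (size w).+1) = false by lia.
  rewrite cats1 !letter_rcons i3 i4 eqSS.
  by case: eqP.
rewrite eqxx cats1 !letter_rcons eqxx (ltn_eqF (ltnSn _)).
by rewrite letter_size addn0.
Qed.

Lemma letter_sizeS w : letter w (size w).+1 = 0.
Proof. by rewrite /letter /= nth_default. Qed.

Lemma tripsumE (F : bool -> bool -> bool -> bool) w :
  \sum_(1 <= i < (size w).+1)
     F (letter w i < letter w i.-1)
       (letter w i < letter w i.+1) (letter w i.+1 < letter w i)
  = tripsum F 0 0 w.
Proof.
rewrite -tripsum_letterE; apply: eq_bigr => i _.
by case: (i =P size w) => // ->; rewrite letter_sizeS.
Qed.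

Lemma valleysE w : valleys w = tripsum valF 0 0 w.
Proof. by rewrite -tripsumE. Qed.

Lemma desE w : des w = tripsum desF 0 0 w.
Proof.
rewrite -tripsumE /des; case: w => [|a w]; first by rewrite !big_geq.
(* Reindexing by lower letters brings in a term for the first letter, which vanishes because the
   letter before it is [0]. *)
by rewrite [RHS]big_ltn // [in RHS]big_add1 /desF /= add0n.
Qed.

Lemma no_double_descentE w : no_double_descent w = (tripsum ddF 0 0 w == 0).
Proof.
rewrite -tripsumE sum_nat_seq_eq0 /no_double_descent /index_iota subn1 /=.
by apply: eq_all => i; rewrite eqb0.
Qed.

Lemma crossingsE c w :
  \sum_(2 <= i < (size w).+1) ((c < letter w i.-1) && (letter w i < c))
  = crossings c 0 w.
Proof.
elim/last_ind: w => [|w d IH]; first by rewrite big_geq.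
rewrite -cats1 crossings_cat -IH cats1 size_rcons /= addn0.
case: w IH => [|a w] IH; first by rewrite !big_geq.
rewrite big_nat_recr //=; congr addn.
  apply: eq_big_nat => i /andP[i1 i2]; rewrite -rcons_cons !letter_rcons.
  have -> : (i == (size (a :: w)).+1) = false by move: i2 => /=; lia.
  by have -> : (i.-1 == (size (a :: w)).+1) = false by move: i2 => /=; lia.
have <- : letter (a :: w) (size (a :: w)) = last a w := letter_size _.
rewrite -rcons_cons !letter_rcons /= eqxx.
by rewrite (ltn_eqF (ltnSn _)).
Qed.

Lemma lesE w : les w = les_from [::] w.
Proof.
elim/last_ind: w => [|w d IH]; first by rewrite /les big_geq.
rewrite -cats1 les_from_cat -IH cats1 /= addn0 -crossingsE /les size_rcons.
case: w IH => [|a w] IH; first by rewrite !big_geq.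
rewrite big_nat_recr //= [X in _ + X]big_geq // addn0 -big_split /=.
apply: eq_big_nat => i /andP[i1 i2]; rewrite big_nat_recr //=.
have e1 : (i == (size (a :: w)).+1) = false by move: i2 => /=; lia.
have e2 : (i.-1 == (size (a :: w)).+1) = false by move: i2 => /=; lia.
rewrite -rcons_cons !letter_rcons e1 e2 eqxx; congr addn.
apply: eq_big_nat => j /andP[j1 j2]; rewrite letter_rcons.
by have -> : (j == (size (a :: w)).+1) = false by move: j2 => /=; lia.
Qed.

Lemma les_from_cons2 c d pre w :
  les_from (c :: d :: pre) w
  = count (fun a => (a < c) && (d < a)) w + les_from (d :: pre) w.
Proof.
elim: w pre => [|a w IH] pre //=.
rewrite IH; lia.
Qed.

Lemma count_letterE (P : pred nat) w :
  \sum_(1 <= i < (size w).+1) P (letter w i) = count P w.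
Proof.
rewrite big_add1 /= -sum1_count [RHS]big_mkcond [RHS](big_nth 0) !big_mkord.
by apply: eq_bigr => i _; case: (P _).
Qed.

(** Read backwards, an ascent to the right of a letter becomes a descent to its left; [res] thereby
    inherits the results on [les]. *)
Lemma resE w : res w = les_from [::] (rev w).
Proof.
elim/last_ind: w => [|w d IH]; first by rewrite /res big_geq.
rewrite rev_rcons /=; case/lastP: w IH => [|w c] IH.
  by rewrite /res /= big_geq.
rewrite rev_rcons /= les_from_cons2 count_rev -(count_letterE (fun a => (a < d) && (c < a))).
rewrite rev_rcons /= add0n in IH; rewrite -IH /res !size_rcons big_nat_recr //= addnC.
rewrite !add0n; congr addn.
  apply: eq_big_nat => i /andP[i1 i2]; rewrite !letter_rcons size_rcons !eqSS eqxx.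
  have -> : (i == (size w).+1) = false by lia.
  have -> : (i == (size w).+2) = false by lia.
  by have -> : (size w == (size w).+1) = false by lia.
apply: eq_big_nat => i /andP[i1 i2]; apply: eq_big_nat => j /andP[j1 j2].
rewrite !(letter_rcons (rcons _ _)) !size_rcons.
have -> : (i == (size w).+2) = false by lia.
have -> : (j == (size w).+2) = false by lia.
by have -> : (i.+1 == (size w).+2) = false by lia.
Qed.

(** * Words with gaps *)

Section GapWords.

(* Gaps are encoded by a letter [N] larger than all others, so that [les], [res]
   and [des] keep their meaning on unfinished words. *)
Variable N : nat.
Hypothesis N_gt0 : 0 < N.

Local Notation gaps := (count_mem N).

(** A gap stands for a maximal run of missing letters, so two gaps are never adjacent. *)
Definition nogap2 (a b : nat) := (a != N) || (b != N).

Definition small (y c : nat) := (0 < c <= y) || (c == N).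

Definition gapword (y : nat) (S : seq nat) :=
  perm_eq [seq c <- S | c != N] (iota 1 y) && sorted nogap2 S.

(** The pair [uv] holds the two sides of the chosen gap, and [ab] tells whether a gap survives to
    the left and to the right of [Y]. As gaps are large letters, [(true, true)] makes [Y] a valley,
    [(true, false)] a double descent, [(false, true)] a double ascent and [(false, false)] a
    peak. *)
Definition fill (Y : nat) (uv : seq nat * seq nat) (ab : bool * bool) : seq nat :=
  uv.1 ++ nseq ab.1 N ++ Y :: nseq ab.2 N ++ uv.2.

Fixpoint splits (S : seq nat) : seq (seq nat * seq nat) :=
  if S is c :: s then
    (if c == N then [:: ([::], s)] else [::]) ++
    [seq (c :: uv.1, uv.2) | uv <- splits s]
  else [::].

Definition fillings (Y : nat) (S : seq nat) : seq (seq nat) :=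
  [seq fill Y uv ab |
     uv <- splits S,
     ab <- [:: (true, true); (true, false); (false, true); (false, false)]].

Fixpoint level (y : nat) : seq (seq nat) :=
  if y is y'.+1 then flatten [seq fillings y T | T <- level y'] else [:: [:: N]].

Lemma mem_splits S u v : ((u, v) \in splits S) = (S == u ++ N :: v).
Proof.
elim: S u => [|c s IH] u /=; first by case: u.
rewrite mem_cat; case: u => [|d u] /=.
  have -> : (([::], v) \in [seq (c :: uv.1, uv.2) | uv <- splits s]) = false.
    by apply/negP => /mapP[[u' v'] _].
  rewrite orbF eqseq_cons; case: ifP => //= _.
  by rewrite inE xpair_eqE eqxx /= eq_sym.
have -> : ((d :: u, v) \in (if c == N then [:: ([::], s)] else [::])) = false.
  by case: ifP => //= _; rewrite inE.
rewrite /= eqseq_cons -IH; apply/mapP/andP.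
  by case=> [[u' v']] h /= [-> -> ->]; rewrite eqxx.
by case=> /eqP-> h; exists (u, v).
Qed.

Lemma uniq_splits S : uniq (splits S).
Proof.
elim: S => [|c s IH] //=; rewrite cat_uniq; apply/and3P; split.
- by case: ifP.
- apply/hasPn => -[u v] /mapP[[u' v'] _ /= [-> _]].
  by case: ifP => // _; rewrite inE.
- by rewrite map_inj_uniq // => -[u v] [u' v'] /= [-> ->].
Qed.

Lemma uniq_flatten_splits L : uniq L -> uniq (flatten [seq splits T | T <- L]).
Proof.
elim: L => [|S L IH] //= /andP[nS uL]; rewrite cat_uniq uniq_splits IH // andbT /=.
apply/hasPn => -[u v] /flatten_mapP[T TL]; rewrite !mem_splits => /eqP eT.
by apply: contra nS => /eqP->; rewrite -eT.
Qed.

Lemma fillingsP Y S T :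
  reflect (exists u v a b, S = u ++ N :: v /\ T = fill Y (u, v) (a, b))
          (T \in fillings Y S).
Proof.
apply: (iffP allpairsP).
  case=> [[[u v] [a b]]] /= []; rewrite mem_splits => /eqP eS _ ->.
  by exists u, v, a, b.
case=> u [v [a [b [-> ->]]]]; exists ((u, v), (a, b)); split => //=.
  by rewrite mem_splits.
by case: a b => [] [].
Qed.

Lemma sorted_path0 S : sorted nogap2 S = path nogap2 0 S.
Proof.
case: S => //= a S; have -> //: nogap2 0 a.
by rewrite /nogap2 (ltn_eqF N_gt0).
Qed.

Lemma gapword_small y S : gapword y S -> all (small y) S.
Proof.
case/andP => /perm_mem h _; apply/allP => c cS; rewrite /small.
case: (eqVneq c N) => [_|cN]; first by rewrite orbT.
have := h c; rewrite mem_filter cN cS mem_iota /= => /esym.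
by rewrite orbF; lia.
Qed.

Lemma gapword_splitE y u v :
  gapword y (u ++ N :: v) =
  [&& perm_eq [seq c <- u ++ v | c != N] (iota 1 y),
      path nogap2 0 u, last 0 u != N, head 0 v != N & path nogap2 0 v].
Proof.
rewrite /gapword sorted_path0 cat_path /= !filter_cat /= eqxx /=.
congr andb; congr andb; rewrite {1}/nogap2 eqxx orbF; congr andb.
case: v => [|c v] /=; first by rewrite (ltn_eqF N_gt0).
by rewrite /nogap2 eqxx (ltn_eqF N_gt0) /=.
Qed.

Lemma iota1S y : 1 :: iota 2 y = rcons (iota 1 y) y.+1.
Proof. by rewrite -[1 :: _]/(iota 1 y.+1) -(addn1 y) iotaD cats1 addnC. Qed.

Lemma gapword_fill y u v a b :
  y.+1 < N -> gapword y (u ++ N :: v) -> gapword y.+1 (fill y.+1 (u, v) (a, b)).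
Proof.
move=> yN; rewrite gapword_splitE => /and5P[h1 h2 h3 h4 h5].
have yN' : (y.+1 == N) = false by lia.
have N0 : (0 == N) = false by lia.
rewrite /gapword /fill /=; apply/andP; split.
  rewrite !filter_cat /= !filter_cat yN' /= !filter_nseq eqxx /=.
  rewrite iota1S.
  rewrite -cat1s perm_catCA /= perm_sym perm_rcons perm_cons perm_sym -filter_cat.
  exact: h1.
rewrite sorted_path0 !cat_path h2 /=.
have hv x : path nogap2 x v.
  by case: v h4 h5 {h1} => //= c v h4 /andP[_ ->]; rewrite /nogap2 h4 orbT.
by case: a b => [] [] /=; rewrite ?cat_path /= /nogap2 ?eqxx ?yN' ?h3 ?orbT /= ?hv.
Qed.

(** * Unique decoding of fillings, and levels as an enumeration of gap words *)

Lemma cat_cons_inj (Y : nat) l1 l2 r1 r2 :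
  Y \notin l1 -> Y \notin l2 -> l1 ++ Y :: r1 = l2 ++ Y :: r2 ->
  l1 = l2 /\ r1 = r2.
Proof.
elim: l1 l2 => [|c l1 IH] [|d l2] //=.
- by move=> _ _ [->].
- by rewrite inE negb_or => _ /andP[/eqP h _] [e _]; case: h.
- by rewrite inE negb_or => /andP[/eqP h _] _ [e _]; case: h.
rewrite !inE !negb_or => /andP[_ h1] /andP[_ h2] [-> e].
by case: (IH _ h1 h2 e) => -> ->.
Qed.

Lemma cat_nseq_inj u u' (a a' : bool) :
  last 0 u != N -> last 0 u' != N -> u ++ nseq a N = u' ++ nseq a' N ->
  u = u' /\ a = a'.
Proof.
case: a a' => [] [] /=; rewrite ?cats0 => h h' e.
- by move: e; rewrite !cats1 => /rcons_inj[->].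
- by move: h'; rewrite -e last_cat /= eqxx.
- by move: h; rewrite e last_cat /= eqxx.
- by [].
Qed.

Lemma nseq_cat_inj v v' (b b' : bool) :
  head 0 v != N -> head 0 v' != N -> nseq b N ++ v = nseq b' N ++ v' ->
  v = v' /\ b = b'.
Proof.
case: b b' => [] [] /= h h' e; first by case: e => ->.
- by move: h'; rewrite -e eqxx.
- by move: h; rewrite e eqxx.
- by [].
Qed.

Lemma small_notin y l : y.+1 < N -> all (small y) l -> y.+1 \notin l.
Proof.
move=> yN /allP h; apply/negP => /h; rewrite /small; lia.
Qed.

Lemma gapword_split_small y u v :
  gapword y (u ++ N :: v) -> all (small y) u /\ all (small y) v.
Proof. by move/gapword_small; rewrite all_cat /= => /and3P[-> _ ->]. Qed.

(** The letter [y.+1] occurs only once, which separates the two sides. As [u] does not end and [v]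
    does not begin with a gap, the surviving gaps can be read off next to it. *)
Lemma fill_inj y u v u' v' a b a' b' :
  y.+1 < N -> gapword y (u ++ N :: v) -> gapword y (u' ++ N :: v') ->
  fill y.+1 (u, v) (a, b) = fill y.+1 (u', v') (a', b') ->
  ((u, v), (a, b)) = ((u', v'), (a', b')).
Proof.
move=> yN g g'; rewrite /fill /= !catA.
have [su sv] := gapword_split_small g; have [su' sv'] := gapword_split_small g'.
have ni w (c : bool) : all (small y) w -> y.+1 \notin w ++ nseq c N.
  move=> sw; apply: small_notin => //; rewrite all_cat sw all_nseq /small eqxx.
  by rewrite !orbT.
move/cat_cons_inj => /(_ (ni _ _ su) (ni _ _ su')) [e1 e2].
move: g g'; rewrite !gapword_splitE => /and5P[_ _ l h _] /and5P[_ _ l' h' _].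
have [-> ->] := cat_nseq_inj l l' e1.
by have [-> ->] := nseq_cat_inj h h' e2.
Qed.

Lemma level_gapword y S : y < N -> S \in level y -> gapword y S.
Proof.
elim: y S => [|y IH] S yN /=.
  by rewrite inE => /eqP->; rewrite /gapword /= eqxx.
move/flatten_mapP => [T TL /fillingsP[u [v [a [b [eT ->]]]]]].
by apply: gapword_fill => //; rewrite -eT; apply: IH => //; apply: ltnW.
Qed.

Lemma level_flattenE y :
  level y.+1 =
  [seq fill y.+1 uv ab |
     uv <- flatten [seq splits T | T <- level y],
     ab <- [:: (true, true); (true, false); (false, true); (false, false)]].
Proof.
rewrite /=; elim: (level y) => [|T L IH] //=.
by rewrite map_cat flatten_cat IH.
Qed.

Lemma uniq_level y : y < N -> uniq (level y).
Proof.
elim: y => [|y IH] yN //.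
rewrite level_flattenE; apply: allpairs_uniq => //.
  by apply: uniq_flatten_splits; apply: IH; apply: ltnW.
move=> [[u v] [a b]] [[u' v'] [a' b']].
move=> /allpairsP[[[u1 v1] [a1 b1]] [h1 _ [-> -> -> ->]]].
move=> /allpairsP[[[u2 v2] [a2 b2]] [h2 _ [-> -> -> ->]]].
have gp x z : (x, z) \in flatten [seq splits T | T <- level y] -> gapword y (x ++ N :: z).
  move/flatten_mapP => [T TL]; rewrite mem_splits => /eqP <-.
  by apply: level_gapword => //; apply: ltnW.
by apply: fill_inj => //; apply: gp.
Qed.

Lemma rstripP (l : seq nat) :
  path nogap2 0 l ->
  exists u (a : bool), [/\ l = u ++ nseq a N, last 0 u != N & path nogap2 0 u].
Proof.
case/lastP: l => [|l c].
  by exists [::], false; split => //=; rewrite (ltn_eqF N_gt0).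
rewrite rcons_path => /andP[h1 h2]; case: (eqVneq c N) => [e|ne].
  exists l, true; rewrite e cats1; split => //.
  by move: h2; rewrite /nogap2 e eqxx orbF.
exists (rcons l c), false; rewrite cats0 last_rcons; split => //.
by rewrite rcons_path h1.
Qed.

Lemma lstripP (l : seq nat) :
  path nogap2 0 l ->
  exists v (b : bool), [/\ l = nseq b N ++ v, head 0 v != N & path nogap2 0 v].
Proof.
have N0 : (0 == N) = false by rewrite ltn_eqF.
case: l => [|c l] /=.
  by exists [::], false; split => //=; rewrite N0.
move=> /andP[h1 h2]; case: (eqVneq c N) => [e|ne].
  exists l, true; rewrite e; rewrite e in h2; split => //.
    by case: l h2 => [|d l] /=; [rewrite N0|rewrite /nogap2 eqxx => /andP[]].
  by case: l h2 => [|d l] //= /andP[_ ->]; rewrite /nogap2 N0.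
by exists (c :: l), false; split => //=; rewrite h1 h2.
Qed.

(** The last insertion is undone: the largest letter, together with any gaps beside it, is replaced
    by a single gap. The empty word must be excluded, since level 0 starts from one gap. *)
Lemma mem_level y S : y < N -> S != [::] -> gapword y S -> S \in level y.
Proof.
have N0 : (0 == N) = false by rewrite ltn_eqF.
elim: y S => [|y IH] S yN nS.
  move=> /andP[/perm_size /= /eqP]; rewrite size_filter -leqn0 leqNgt -has_count.
  move=> /hasPn h; have {}h c : c \in S -> c = N.
    by move/h; rewrite negbK => /eqP.
  case: S h nS => [|c [|d S]] // h _.
    by rewrite (h c) ?inE ?eqxx.
  by rewrite (h c) ?inE ?eqxx // (h d) ?inE ?eqxx ?orbT //= /nogap2 eqxx.
move=> g; have /andP[pS sS] := g.
have yS : y.+1 \in S.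
  have := perm_mem pS y.+1; rewrite mem_filter mem_iota /= => e.
  by move: e; rewrite ltnS leqnn => /andP[].
have yN' : (y.+1 == N) = false by lia.
have [l [r eS]] : exists l r, S = l ++ y.+1 :: r.
  by case/splitPr: yS => l r; exists l, r.
move: sS; rewrite sorted_path0 eS cat_path /= => /and3P[pl _ pr].
have [u [a [el lu pu]]] := rstripP pl.
have {}pr : path nogap2 0 r.
  by case: r pr {eS} => //= c r /andP[_ ->]; rewrite /nogap2 N0.
have [v [b [er hv pv]]] := lstripP pr.
apply/flatten_mapP; exists (u ++ N :: v).
  apply: IH; [exact: ltnW|by case: (u)|].
  rewrite gapword_splitE pu lu hv pv !andbT.
  move: pS; rewrite eS el er !filter_cat /= !filter_cat yN' /= !filter_nseq eqxx /=.
  rewrite iota1S.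
  rewrite cats0 -cat1s perm_catCA /= perm_sym perm_rcons perm_cons perm_sym.
  by [].
by apply/fillingsP; exists u, v, a, b; rewrite el er /fill /= -catA.
Qed.

(** * Effect of a filling on the statistics *)

Lemma gaps_fill y u v a b : y.+1 < N ->
  gaps (fill y.+1 (u, v) (a, b)) = gaps u + gaps v + a + b.
Proof.
move=> yN; rewrite /fill /= !count_cat /= !count_cat !count_nseq /= eqxx.
have -> : (y.+1 == N) = false by lia.
by lia.
Qed.

Lemma tripsum_end F e e' x l :
  last x l < e -> last x l < e' -> tripsum F e x l = tripsum F e' x l.
Proof.
elim: l x => [|c l IH] x //= h h'; rewrite (IH c) //; congr addn.
case: l h h' {IH} => //= h h'; rewrite h h'.
by have [-> ->] : (e < c) = false /\ (e' < c) = false by lia.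
Qed.

Lemma tripsum_start F e x x' l :
  head 0 l < x -> head 0 l < x' -> tripsum F e x l = tripsum F e x' l.
Proof. by case: l => //= c l -> ->. Qed.

Lemma crossings_start c x x' l :
  (c < x) = (c < x') -> crossings c x l = crossings c x' l.
Proof. by case: l => //= d l ->. Qed.

(** All proper letters lie below [y.+1] and all gaps above it, so the descents straddling [y.+1] are
    the steps from a gap to the letter after it. The boundary terms account for a final gap, which
    starts no such step, and for an initial gap [x]. *)
Lemma crossings_gaps y x l : y.+1 < N ->
  x <= y \/ x = N -> all (small y) l -> path nogap2 x l ->
  crossings y.+1 x l + (last x l == N) = gaps l + (x == N).
Proof.
move=> yN; elim: l x => [|d l IH] x hx //= /andP[sd sl] /andP[xd pl].
have hd : d <= y \/ d = N by move: sd; rewrite /small; lia.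
have -> : (y.+1 < x) && (d < y.+1) = (x == N) && (d != N).
  by apply/idP/idP; lia.
have := IH d hd sl pl; move: xd; rewrite /nogap2.
case: (eqVneq d N) => _; case: (eqVneq x N) => _ //= _ e; move: e; rewrite /=; lia.
Qed.

(** The suffix [l] stands for the letters of [w] that the recursion has already moved into the
    prefix. *)
Lemma les_from_eq pre pre' w :
  (forall c l, c \in w -> crossings c 0 (pre ++ l) = crossings c 0 (pre' ++ l)) ->
  les_from pre w = les_from pre' w.
Proof.
elim: w pre pre' => [|c w IH] pre pre' h //=; congr addn.
  by have := h c [::]; rewrite !cats0 inE eqxx => ->.
by apply: IH => d l dw; rewrite !cat_rcons; apply: h; rewrite inE dw orbT.
Qed.

Lemma crossings_N y x l : y < N -> x <= N -> all (small y) l -> crossings N x l = 0.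
Proof.
move=> yN; elim: l x => //= d l IH x hx /andP[sd sl]; rewrite IH //.
  by rewrite addn0; move: hx; rewrite leqNgt => /negbTE->.
by move: sd; rewrite /small; lia.
Qed.

Section Filling.

Variables (y : nat) (u v : seq nat).
Hypothesis yN : y.+1 < N.
Hypothesis gS : gapword y (u ++ N :: v).
Local Notation Y := y.+1.

Let su : all (small y) u := (gapword_split_small gS).1.
Let sv : all (small y) v := (gapword_split_small gS).2.

Let last_neqN : last 0 u != N.
Proof. by move: gS; rewrite gapword_splitE => /and5P[]. Qed.

Let head_neqN : head 0 v != N.
Proof. by move: gS; rewrite gapword_splitE => /and5P[]. Qed.

Lemma fill_last_lt : last 0 u < Y.
Proof.
case/lastP: u su last_neqN => [|w c] //; rewrite all_rcons last_rcons /small.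
by case/andP => h _ h2; lia.
Qed.

Lemma fill_head_lt : head 0 v < Y.
Proof.
case: v sv head_neqN => [|c w] //=; rewrite /small.
by case/andP => h _ h2; lia.
Qed.

(** The neighbours of the gap compare with [Y] as they did with [N], and by the condition on [F] a
    gap between smaller letters contributes nothing. Only the term of [Y] is new, and a neighbour of
    [Y] is larger exactly when it is a surviving gap. *)
Lemma tripsum_fill (F : bool -> bool -> bool -> bool) a b :
  (forall c, F false false c = false) ->
  tripsum F 0 0 (fill Y (u, v) (a, b))
  = tripsum F 0 0 (u ++ N :: v) + F a b (~~ b).
Proof.
move=> F0; have lY := fill_last_lt; have hY := fill_head_lt.
rewrite /fill /= !tripsum_cat /= (@tripsum_end _ (head 0 _) N) /=; last 2 first.
- by case: a => //=; lia.
- by lia.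
rewrite -addnA; congr addn.
rewrite (@tripsum_start F 0 N Y v) //; last by lia.
have e1 : (N < last 0 u) = false by lia.
have e2 : (N < head 0 v) = false by lia.
have e3 : (Y < last 0 u) = false by lia.
have e4 : (Y < N) = true by lia.
have e5 : (N < Y) = false by lia.
have e6 : (Y < head 0 v) = false by lia.
rewrite e1 e2 F0 add0n.
case: a b => [] [] /=; rewrite ?e1 ?e2 ?e3 ?e4 ?e5 ?e6 ?hY ?F0 ?add0n addnC //.
all: by rewrite (@tripsum_start F 0 N Y v) //; lia.
Qed.

(** The new letter sees one straddling descent for each gap of [u], because [u] does not end with a
    gap. Gaps see none, and the other letters see as many as before. *)
Lemma les_from_fill a b :
  les_from [::] (fill Y (u, v) (a, b)) = les_from [::] (u ++ N :: v) + gaps u.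
Proof.
have lY := fill_last_lt.
have N0 : (0 == N) = false by lia.
have /and5P[_ pu lu _ _] : [&& perm_eq [seq c <- u ++ v | c != N] (iota 1 y),
      path nogap2 0 u, last 0 u != N, head 0 v != N & path nogap2 0 v].
  by rewrite -gapword_splitE.
have [m mE] : {m | m = nseq a N ++ Y :: nseq b N} by eexists.
have -> : fill Y (u, v) (a, b) = u ++ m ++ v by rewrite /fill mE -catA.
rewrite -cat1s !les_from_cat /= -!addnA; congr addn.
have -> : les_from u m = gaps u.
  have cY : crossings Y 0 u = gaps u.
    have := @crossings_gaps y 0 u yN (or_introl (leq0n _)) su pu.
    by rewrite N0 (negbTE lu); lia.
  have cN : crossings N 0 u = 0 by apply: (crossings_N (ltnW yN)).
  have e : (Y < last 0 u) = false by lia.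
  have e' : (N < Y) = false by lia.
  have e'' : (N < last 0 u) = false by lia.
  by rewrite mE; case: a b {mE} => [] [] /=;
     rewrite -?cats1 -?catA ?crossings_cat /= ?ltnn ?e ?e' ?e'' ?andbF ?andFb /= ?cY ?cN !(addn0, add0n).
rewrite (crossings_N (ltnW yN)) // !add0n addnC; congr addn.
(* For [c] in [v] the tests [c < Y] and [c < N] agree, so [Y] with its gaps takes over the role of
   the old gap. *)
apply: les_from_eq => c l cv.
have hc : c < Y \/ c = N by move/allP: sv => /(_ _ cv); rewrite /small; lia.
rewrite !crossings_cat !last_cat -!addnA; congr addn.
rewrite mE /=; case: a b {mE} => [] [] /=;
  do ?rewrite (@crossings_start c Y N l); lia.
Qed.

End Filling.

Lemma rev_fill Y u v a b : rev (fill Y (u, v) (a, b)) = fill Y (rev v, rev u) (b, a).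
Proof. by rewrite /fill /= !rev_cat rev_cons rev_cat !rev_nseq -!cats1 -!catA. Qed.

Lemma gapword_rev y S : gapword y (rev S) = gapword y S.
Proof.
rewrite /gapword filter_rev perm_rev rev_sorted.
have -> // : sorted (fun z x => nogap2 x z) S = sorted nogap2 S.
by apply: eq_sorted => a b; rewrite /nogap2 orbC.
Qed.

Lemma les_fill y u v a b : y.+1 < N -> gapword y (u ++ N :: v) ->
  les (fill y.+1 (u, v) (a, b)) = les (u ++ N :: v) + gaps u.
Proof. by move=> yN gS; rewrite !lesE (les_from_fill yN gS). Qed.

Lemma res_fill y u v a b : y.+1 < N -> gapword y (u ++ N :: v) ->
  res (fill y.+1 (u, v) (a, b)) = res (u ++ N :: v) + gaps v.
Proof.
have rE : rev (u ++ N :: v) = rev v ++ N :: rev u.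
  by rewrite rev_cat rev_cons cat_rcons.
move=> yN; rewrite -gapword_rev rE => gS.
by rewrite !resE rev_fill (les_from_fill yN gS) rE count_rev.
Qed.

(* The gap in front of [v] is locked when it is the left slot of the letter
   heading [v] while the right slot of that letter is still empty. *)
Definition locked (v : seq nat) : bool :=
  if v is x :: c :: v' then (c == N) && (head 0 v' < x) else false.

(** Here [last 0 (belast 0 u)] is the letter of [u] before its last one, or [0]. The condition says
    that the gap between [u] and [v] is the empty right slot of the last letter of [u], whose left
    slot is still a gap. *)
Definition unlocks (u v : seq nat) : bool :=
  (last 0 (belast 0 u) == N) && (head 0 v < last 0 u).

Fixpoint locks (S : seq nat) : nat :=
  if S is c :: S' then ((c == N) && locked S') + locks S' else 0.

(** Whether a gap is locked depends only on the three letters after it, and the second of them must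
    be a gap. Since [x] is none, [c] is the only position up to [x] whose lock can depend on [w]. *)
Lemma locks_cat2 u c x w : x != N ->
  locks (u ++ c :: x :: w)
  = locks (u ++ [:: c; x]) + ((c == N) && locked (x :: w)) + locks w.
Proof.
move=> xN; elim: u => [|d u IH] /=; first by rewrite (negbTE xN) !andbF.
have -> : locked (u ++ [:: c, x & w]) = locked (u ++ [:: c; x]).
  by case: u {IH} => [|e [|f [|g u]]] //=; rewrite (negbTE xN).
by rewrite IH !addnA.
Qed.

(** A valley has a smaller letter behind its right gap, so its left gap becomes locked. The only old
    gap whose status can change stands two letters before the filled one; it was locked exactly when
    [unlocks u v] holds. *)
Lemma locks_fill y u v a b : y.+1 < N -> gapword y (u ++ N :: v) ->
  ~~ locked v ->
  locks (fill y.+1 (u, v) (a, b)) + unlocks u v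
  = locks (u ++ N :: v) + (a && b).
Proof.
move=> yN gS nl; have lY := fill_last_lt yN gS; have hY := fill_head_lt yN gS.
have YN : (y.+1 == N) = false by lia.
have hN : head 0 v == N = false.
  by move: gS; rewrite gapword_splitE => /and5P[_ _ _ /negbTE].
have lN : last 0 u != N by move: gS; rewrite gapword_splitE => /and5P[].
have N0 : (0 == N) = false by lia.
have fE : locks (nseq a N ++ y.+1 :: nseq b N ++ v) = locks v + (a && b).
  case: a b => [] [] /=; rewrite ?eqxx ?YN ?(negbTE nl) ?hY /=; try lia.
  by rewrite addn0; case: v hN {gS nl hY} => //= c v ->.
have gE : locks (N :: v) = locks v by rewrite /= eqxx (negbTE nl).
rewrite /fill /unlocks /=; case/lastP: u gS lY lN => [|u x] gS lY lN.
  by rewrite /= N0 fE eqxx (negbTE nl) addn0.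
rewrite belast_rcons !last_rcons /= in lY lN *.
case/lastP: u gS => [|u c] gS.
  by rewrite /= (negbTE lN) N0 /= fE eqxx (negbTE nl) addn0.
rewrite last_rcons !cat_rcons (@locks_cat2 u c x (N :: v)) //.
rewrite (@locks_cat2 u c x (nseq a N ++ _)) // fE gE.
have -> : locked [:: x, N & v] = (head 0 v < x) by rewrite /= eqxx.
have -> : locked (x :: nseq a N ++ y.+1 :: nseq b N ++ v) = false.
  by case: a {fE} => /=; rewrite ?YN ?eqxx //=; lia.
rewrite andbF; lia.
Qed.

(** If both held, the last letter of [u], the head [x] of [v] and the letter after the next gap
    would be decreasing, and [x] would be a double descent once the gaps are erased. *)
Lemma gapword_locked_unlocks y u v :
  y.+1 < N -> gapword y (u ++ N :: v) ->
  tripsum ddF 0 0 (subword (u ++ N :: v) y) = 0 ->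
  unlocks u v -> ~~ locked v.
Proof.
move=> yN gS.
have [su sv] := gapword_split_small gS.
have lY := fill_last_lt yN gS; have hY := fill_head_lt yN gS.
have Ny : (0 < N <= y) = false by lia.
rewrite /subword filter_cat /= Ny tripsum_cat.
move=> /eqP; rewrite addn_eq0 => /andP[_ /eqP dd] /andP[_ hl].
apply/negP; case: v sv hl hY dd gS => [|x [|c w]] //= /andP[sx /andP[sc sw]] hl hY dd gS.
case/andP => /eqP cN hw; rewrite cN in dd gS.
have lu : last 0 [seq a <- u | 0 < a <= y] = last 0 u.
  case/lastP: u lY su hl {dd gS} => [|u z]; first by [].
  rewrite filter_rcons last_rcons => zY; rewrite all_rcons /small => /andP[sz _] hz.
  have -> : 0 < z <= y by lia.
  by rewrite last_rcons.
have hN : head 0 w != N.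
  move: gS; rewrite (_ : _ ++ _ = (u ++ [:: N; x]) ++ N :: w) -?catA //.
  by rewrite catA gapword_splitE => /and5P[].
have hw' : head 0 [seq a <- w | 0 < a <= y] = head 0 w.
  case: w sw hN {hw dd gS} => //= d w /andP[sd _] dN.
  have -> : 0 < d <= y by move: sd; rewrite /small; lia.
  by [].
have xy : 0 < x <= y by lia.
by move: dd; rewrite xy Ny /= lu hl hw' /ddF hw.
Qed.

(** * The Andre condition under filling *)

Lemma tripsum_dd_end e e' x l : last x l < e' ->
  tripsum ddF e x l = 0 -> tripsum ddF e' x l = 0.
Proof.
elim: l x => [|c l IH] x //= h /eqP; rewrite addn_eq0 => /andP[/eqP h1 /eqP h2].
rewrite (IH c) // addn0; case: l h h1 {IH h2} => //= h _.
have -> : (e' < c) = false by lia.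
by rewrite /ddF andbF.
Qed.

(** A new maximum can create a double descent only at the letter right after it. *)
Lemma tripsum_dd_insert Y u v :
  last 0 u < Y -> head 0 v < Y -> tripsum ddF 0 0 (u ++ v) = 0 ->
  (tripsum ddF 0 0 (u ++ Y :: v) == 0)
  = ~~ (if v is c :: v' then head 0 v' < c else false).
Proof.
move=> lY hY /eqP; rewrite !tripsum_cat addn_eq0 => /andP[/eqP h1 /eqP h2] /=.
rewrite (tripsum_dd_end lY h1) {2}/ddF.
have -> : (Y < last 0 u) = false by lia.
case: v hY h2 {h1} => [|c v] //= cY /eqP; rewrite addn_eq0 => /andP[_ /eqP->].
by rewrite /ddF cY /= addn0 add0n eqb0.
Qed.

(** Extension to unfinished words: in [S] itself gaps count as large letters, whereas in the
    subwords they disappear. The final ascent is left out because the closing [0] turns a final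
    descent into a double descent. *)
Definition andre (y : nat) (S : seq nat) : bool :=
  (tripsum ddF 0 0 S == 0) &&
  all (fun k => tripsum ddF 0 0 (subword S k) == 0) (iota 1 y).

Lemma andre_subword y S : andre y S -> tripsum ddF 0 0 (subword S y) = 0.
Proof.
case/andP => _ /allP h; case: (posnP y) => [->|y0].
  rewrite /subword; have -> // : [seq a <- S | 0 < a <= 0] = [::].
  by apply/eqP; rewrite -[_ == _]negbK -has_filter; apply/hasPn => c _; lia.
by apply/eqP; apply: h; rewrite mem_iota; lia.
Qed.

(** The subwords up to [y] do not change. In the next one, [y.+1] creates a double descent when the
    head of [v] exceeds the next letter of the subword. As that head is no double descent of the gap
    word, a gap must stand between the two letters, and this is the locked pattern. *)
Lemma andre_fill y u v a b : y.+1 < N -> gapword y (u ++ N :: v) ->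
  andre y.+1 (fill y.+1 (u, v) (a, b))
  = [&& andre y (u ++ N :: v), ~~ locked v & ~~ (a && ~~ b)].
Proof.
move=> yN gS; rewrite /andre.
have [su sv] := gapword_split_small gS.
have lY := fill_last_lt yN gS; have hY := fill_head_lt yN gS.
have subE k : k <= y -> subword (fill y.+1 (u, v) (a, b)) k = subword (u ++ N :: v) k.
  move=> ky; rewrite /subword /fill /= !filter_cat /= !filter_cat !filter_nseq.
  have -> : (0 < N <= k) = false by lia.
  by have -> : (y < k) = false by lia.
rewrite [iota 1 y.+1]iota1S all_rcons (tripsum_fill yN gS) // addn_eq0 eqb0.
rewrite -[ddF a b (~~ b)]/(a && ~~ b).
have -> : all (fun k => tripsum ddF 0 0 (subword (fill y.+1 (u, v) (a, b)) k) == 0) (iota 1 y)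
   = all (fun k => tripsum ddF 0 0 (subword (u ++ N :: v) k) == 0) (iota 1 y).
  by apply: eq_in_all => k; rewrite mem_iota => ky; rewrite subE //; lia.
set B := all _ _; set D := tripsum _ _ _ (_ ++ _) == 0.
case hD : D => //=; case hB : B; last by rewrite !andbF.
rewrite !andbT /= andbC; congr andb.
have d0 : tripsum ddF 0 0 (subword (u ++ N :: v) y) = 0.
  by apply: andre_subword; rewrite /andre -/B hB andbT.
have yNf : (0 < N <= y) = false by lia.
have sE w : all (small y) w -> [seq a0 <- w | 0 < a0 <= y.+1] = [seq a0 <- w | 0 < a0 <= y].
  move=> /allP sw; apply: eq_in_filter => c /sw; rewrite /small; lia.
have -> : subword (fill y.+1 (u, v) (a, b)) y.+1
   = [seq a0 <- u | 0 < a0 <= y] ++ y.+1 :: [seq a0 <- v | 0 < a0 <= y].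
  rewrite /subword /fill /= !filter_cat /= !filter_cat !filter_nseq ltnSn.
  have -> : (0 < N <= y.+1) = false by lia.
  by rewrite !sE.
move: d0; rewrite /subword filter_cat /= yNf => d0.
have fY w : all (fun c => c <= y) [seq a0 <- w | 0 < a0 <= y].
  by apply/allP => c; rewrite mem_filter => /andP[/andP[]].
rewrite tripsum_dd_insert //; last 2 first.
- case/lastP: [seq a0 <- u | 0 < a0 <= y] (fY u) => // w c.
  by rewrite all_rcons last_rcons => /andP[].
- by case: [seq a0 <- v | 0 < a0 <= y] (fY v) => //= c w /andP[].
congr negb.
have hN : head 0 v != N by move: gS; rewrite gapword_splitE => /and5P[].
move: hD; rewrite /D tripsum_cat addn_eq0 => /andP[_] /=.
rewrite addn_eq0 => /andP[_].
case: v sv hN hY gS {d0 subE D B hB} => [|c v] //= /andP[sc sv] cN cY gS.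
rewrite addn_eq0 eqb0 => /andP[hc _].
have cy : 0 < c <= y by move: sc cN; rewrite /small; lia.
have cltN : c < N by lia.
rewrite cy /=.
move: hc; rewrite /ddF cltN /=.
case: v sv gS => [|d v] /=; first by lia.
move=> /andP[sd sv] gS nd; case: (eqVneq d N) => [dN|dN] /=; last first.
  have -> : 0 < d <= y by move: sd dN; rewrite /small; lia.
  by rewrite /=; apply/negbTE.
rewrite dN yNf; rewrite dN in gS.
have {}hN : head 0 v != N.
  move: gS; rewrite (_ : _ ++ _ = (u ++ [:: N; c]) ++ N :: v) -?catA //.
  by rewrite catA gapword_splitE => /and5P[].
case: v sv hN {gS} => [|e v] //= /andP[se _] eN.
have -> : 0 < e <= y by move: se eN; rewrite /small; lia.
by [].
Qed.

(** The gap set free lies in [u]; hence [gaps u - unlocks u v] never truncates. *)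
Lemma unlocks_le_gaps u v : unlocks u v <= gaps u.
Proof.
rewrite /unlocks; case: eqP => //= e; case: (_ < _) => //=.
rewrite -has_count; apply/hasP; exists N => //=.
case/lastP: u e => [|u x] /=; first by lia.
rewrite belast_rcons /= mem_rcons inE.
case/lastP: u => [|u c] /=; first by lia.
by rewrite last_rcons mem_rcons inE => ->; rewrite eqxx orbT.
Qed.

(** Each filling preserves the three claims. For the last bound, a valley raises the number of locks
    too, and an unlocking loses a lock but adds at least one to [les]. The two inequalities keep the
    exponents of [wtD] from truncating. *)
Lemma level_stats y S : y < N -> S \in level y ->
  [/\ tripsum desF 0 0 S = tripsum valF 0 0 S + tripsum ddF 0 0 S,
      y + gaps S = (tripsum valF 0 0 S).*2.+1 + tripsum daF 0 0 S + tripsum ddF 0 0 S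
    & andre y S -> locks S <= tripsum valF 0 0 S <= les S + locks S].
Proof.
elim: y S => [|y IH] S yN.
  by rewrite inE => /eqP->; rewrite /= /desF /valF /ddF /daF ?ltn0 eqxx.
move=> /flatten_mapP[T TL /fillingsP[u [v [a [b [eT ->]]]]]].
have yN' := ltnW yN; have gT := level_gapword yN' TL.
have [h1 h2 h3] := IH T yN' TL; rewrite eT in gT h1 h2 h3.
rewrite !(tripsum_fill yN gT) // (gaps_fill _ _ _ _ yN) (les_fill _ _ yN gT) (andre_fill _ _ yN gT).
have gE : gaps (u ++ N :: v) = gaps u + gaps v + 1.
  by rewrite count_cat /= eqxx; lia.
rewrite gE in h2; split.
- by rewrite h1 /desF /valF /ddF; case: a b => [] [] /=; lia.
- have [-> -> ->] : [/\ valF a b (~~ b) = a && b, daF a b (~~ b) = ~~ a && b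
      & ddF a b (~~ b) = a && ~~ b] by [].
  move: h2; move: (tripsum valF _ _ _) (tripsum daF _ _ _) (tripsum ddF _ _ _).
  by move: (gaps u) (gaps v); clear; case: a b => [] [] /=; lia.
case/and3P => aT nl _; have := locks_fill a b yN gT nl; have := h3 aT.
have := unlocks_le_gaps u v.
have : valF a b (~~ b) = a && b by [].
move=> ->; case: (unlocks _ _) (a && b) => [] [] /=; lia.
Qed.

(** * Weighted path counting *)

Section Weights.

Local Open Scope ring_scope.

Variables (R : comNzRingType) (p q t : R).

(** The p,q-integer [[m]], that is p^(m-1) + p^(m-2) q + ... + q^(m-1). *)
Fixpoint pqint (m : nat) : R := if m is m'.+1 then p ^+ m' + q * pqint m' else 0.

(** Weighted paths of [k] steps from height [m] down to 0, the height being the number of gaps. The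
    factor [pqint 0 = 0] forbids steps from height 0, so the truncation in [m.-1] is harmless. *)
Fixpoint motzkin (k m : nat) : R :=
  if k is k'.+1 then
    pqint m * ((1 + t) * motzkin k' m + t * motzkin k' m.+1 + motzkin k' m.-1)
  else (m == 0)%:R.

Lemma sum_splits_cons c S (f : seq nat -> seq nat -> R) :
  \sum_(uv <- splits (c :: S)) f uv.1 uv.2
  = (if c == N then f [::] S else 0) + \sum_(uv <- splits S) f (c :: uv.1) uv.2.
Proof. by rewrite /= big_cat big_map; case: eqP; rewrite ?big_seq1 ?big_nil. Qed.

Lemma sum_splits_pqint S :
  \sum_(uv <- splits S) q ^+ gaps uv.1 * p ^+ gaps uv.2 = pqint (gaps S).
Proof.
elim: S => [|c S IH]; first by rewrite big_nil.
rewrite (sum_splits_cons c S (fun u v => q ^+ gaps u * p ^+ gaps v)) /=.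
case: eqP => _ /=; last by rewrite !add0r.
rewrite expr0 mul1r -IH mulr_sumr; congr (_ + _).
by apply: eq_bigr => uv _; rewrite exprS mulrA.
Qed.

(* A locked gap and the gap that unlocks it stand two letters apart. *)
Lemma sum_locked_unlocks P S : path nogap2 (last 0 P) S ->
  \sum_(uv <- splits S)
     (if unlocks (P ++ uv.1) uv.2
      then q ^+ (gaps (P ++ uv.1)).-1 * p ^+ (gaps uv.2).+1 else 0)
  = (if (head 0 S == N) && unlocks P (behead S)
     then q ^+ (gaps P).-1 * p ^+ gaps S else 0)
    + (if (last 0 P == N) && locked S then q ^+ (gaps P).-1 * p ^+ gaps S else 0)
    + \sum_(uv <- splits S)
        (if locked uv.2 then q ^+ gaps (P ++ uv.1) * p ^+ gaps uv.2 else 0).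
Proof.
have N0 : (0%N == N) = false by rewrite ltn_eqF.
elim: S P => [|c S IH] P; first by rewrite !big_nil /= N0 andbF !addr0.
move=> /= /andP[hc hS].
rewrite (sum_splits_cons c S (fun u v => if unlocks (P ++ u) v
      then q ^+ (gaps (P ++ u)).-1 * p ^+ (gaps v).+1 else 0)).
rewrite (sum_splits_cons c S (fun u v => if locked v
      then q ^+ gaps (P ++ u) * p ^+ gaps v else 0)).
under eq_bigr do rewrite -cat_rcons.
under [in RHS]eq_bigr do rewrite -cat_rcons.
rewrite IH ?last_rcons // !cats0.
rewrite -!addrA; congr (_ + _); first by case: eqP.
rewrite !addrA; congr (_ + _); congr (_ + _).
  (* Once [c] belongs to the prefix, a gap at the head of [S] that unlocks the gap before [c]
     expresses the same pattern as that earlier gap being locked by [c :: S]. *)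
  case: S hS {IH} => [|d S] hS; first by rewrite /= N0 andbF.
  rewrite /unlocks belast_rcons /= last_rcons.
  case: (eqVneq d N) => [dN|]; last by rewrite andbF.
  case: eqP => //= lN; case: ifP => // _.
  have cN : (c == N) = false.
    by move: hc; rewrite /nogap2 lN eqxx => /negbTE.
  by rewrite -cats1 count_cat /= cN !addn0.
case: eqP => //= cN; case: ifP => // _.
by rewrite -cats1 count_cat /= cN eqxx !addn0 addn1.
Qed.

Lemma sum_splits_unlocked y S : (y.+1 < N)%N -> gapword y S ->
  tripsum ddF 0 0 (subword S y) = 0%N ->
  \sum_(uv <- splits S)
     (if locked uv.2 then 0
      else q ^+ (gaps uv.1 - unlocks uv.1 uv.2) * (p + q) ^+ unlocks uv.1 uv.2
           * p ^+ gaps uv.2)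
  = pqint (gaps S).
Proof.
move=> yN gS dS; rewrite -sum_splits_pqint.
have N0 : (0%N == N) = false by rewrite ltn_eqF.
have pS : path nogap2 (last 0%N [::]) S by rewrite -sorted_path0; case/andP: gS.
have := sum_locked_unlocks pS.
rewrite /= {2}/unlocks /= N0 andbF !add0r => e.
(* The weights of the locked gaps are added to both sides. On the right [e] turns them into terms at
   the unlocking gaps, after which the sums agree term by term. *)
apply: (addIr (\sum_(uv <- splits S)
        (if locked uv.2 then q ^+ gaps uv.1 * p ^+ gaps uv.2 else 0))).
rewrite -{2}e -!big_split /= big_seq [RHS]big_seq; apply: eq_bigr => -[u v].
rewrite mem_splits => /eqP eS /=; rewrite eS in gS dS.
have := gapword_locked_unlocks yN gS dS.
case hu : (unlocks u v) => hl; last first.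
  by case: (locked v); rewrite ?add0r ?addr0 //= subn0 expr0 mulr1.
rewrite (negbTE (hl isT)) addr0 expr1.
have := unlocks_le_gaps u v; rewrite hu.
case: (gaps u) => // m _; rewrite subn1 /= !exprS; ring.
Qed.

Lemma sum_fillings Y S (f : seq nat -> R) :
  \sum_(T <- fillings Y S) f T
  = \sum_(uv <- splits S)
      (f (fill Y uv (true, true)) + f (fill Y uv (true, false))
       + f (fill Y uv (false, true)) + f (fill Y uv (false, false))).
Proof.
rewrite /fillings big_flatten big_map; apply: eq_bigr => uv _.
by rewrite /= !big_cons big_nil addr0 !addrA.
Qed.

(** One insertion is one path step. Only the sum of the two level fillings is prescribed, so 1 + t
    may be shared between double descents and double ascents or carried by the latter alone. *)
Lemma sum_fillings_motzkin y S (wt wt' : seq nat -> R) (g : seq nat -> seq nat -> R) k :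
  (y.+1 < N)%N ->
  (forall u v, S = u ++ N :: v ->
     [/\ wt' (fill y.+1 (u, v) (true, true)) = wt S * g u v * t,
         wt' (fill y.+1 (u, v) (true, false)) + wt' (fill y.+1 (u, v) (false, true))
         = wt S * g u v * (1 + t)
       & wt' (fill y.+1 (u, v) (false, false)) = wt S * g u v]) ->
  \sum_(uv <- splits S) g uv.1 uv.2 = pqint (gaps S) ->
  \sum_(T <- fillings y.+1 S) wt' T * motzkin k (gaps T)
  = wt S * motzkin k.+1 (gaps S).
Proof.
move=> yN hw hg; rewrite sum_fillings /= -hg mulr_suml mulr_sumr.
rewrite big_seq [RHS]big_seq; apply: eq_bigr => -[u v].
rewrite mem_splits => /eqP eS; have [h1 h2 h3] := hw u v eS.
have gE : gaps S = (gaps u + gaps v).+1.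
  by rewrite eS count_cat /= eqxx; lia.
rewrite !(gaps_fill _ _ _ _ yN) /= !addn0 !addn1 -gE -[(gaps u + gaps v)%N]/((gaps u + gaps v).+1.-1) -gE.
rewrite h1 h3 -[X in X + _ = _]addrA -mulrDl h2; ring.
Qed.

(** The sum over a level of [wt] times [motzkin] of the remaining steps is invariant. With no step
    left, [motzkin 0] selects the words without gaps. *)
Lemma sum_level (wt : nat -> seq nat -> R) n :
  (forall y S k, (y.+1 < N)%N -> S \in level y ->
     \sum_(T <- fillings y.+1 S) wt y.+1 T * motzkin k (gaps T)
     = wt y S * motzkin k.+1 (gaps S)) ->
  (n < N)%N ->
  \sum_(T <- level n | N \notin T) wt n T = wt 0%N [:: N] * motzkin n 1.
Proof.
move=> step nN.
have h k y : (y + k < N)%N ->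
    \sum_(T <- level (y + k)) wt (y + k)%N T * motzkin 0 (gaps T)
    = \sum_(T <- level y) wt y T * motzkin k (gaps T).
  elim: k y => [|k IH] y ykN; first by rewrite addn0.
  rewrite addnS -addSn in ykN *; rewrite IH //= big_flatten big_map /=.
  rewrite big_seq [RHS]big_seq; apply: eq_bigr => S SL.
  by apply: step => //; apply: leq_ltn_trans ykN; rewrite leq_addr.
have := h n 0%N nN; rewrite add0n /= big_seq1 /= eqxx addn0 => <-.
rewrite big_mkcond; apply: eq_bigr => T _.
by rewrite -has_pred1 has_count -leqNgt leqn0; case: (_ == _); rewrite ?mulr1 ?mulr0.
Qed.

Definition wtA (S : seq nat) : R :=
  p ^+ res S * q ^+ les S * t ^+ tripsum desF 0 0 S.

Definition wtG (S : seq nat) : R :=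
  if tripsum ddF 0 0 S == 0%N then
    p ^+ res S * q ^+ les S * t ^+ tripsum valF 0 0 S * (1 + t) ^+ tripsum daF 0 0 S
  else 0.

(* A valley trades a factor [q] for [p + q] at the moment its left gap is unlocked. *)
Definition wtD (y : nat) (S : seq nat) : R :=
  if andre y S then
    p ^+ res S * q ^+ (les S + locks S - tripsum valF 0 0 S)
    * (p + q) ^+ (tripsum valF 0 0 S - locks S)
    * t ^+ tripsum valF 0 0 S * (1 + t) ^+ tripsum daF 0 0 S
  else 0.

Lemma sum_wtA n : (n < N)%N ->
  \sum_(T <- level n | N \notin T) wtA T = wtA [:: N] * motzkin n 1.
Proof.
apply: (@sum_level (fun=> wtA)) => y S k yN SL; have gS := level_gapword (ltnW yN) SL.
apply: (@sum_fillings_motzkin _ _ _ _ (fun u v => q ^+ gaps u * p ^+ gaps v)) => //.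
  move=> u v eS; rewrite eS in gS; rewrite eS /wtA.
  rewrite !(tripsum_fill yN gS) // !(les_fill _ _ yN gS) !(res_fill _ _ yN gS).
  by rewrite /desF /= !addn0 !addn1 !exprD !exprS; split; ring.
exact: sum_splits_pqint.
Qed.

Lemma sum_wtG n : (n < N)%N ->
  \sum_(T <- level n | N \notin T) wtG T = wtG [:: N] * motzkin n 1.
Proof.
apply: (@sum_level (fun=> wtG)) => y S k yN SL; have gS := level_gapword (ltnW yN) SL.
apply: (@sum_fillings_motzkin _ _ _ _ (fun u v => q ^+ gaps u * p ^+ gaps v)) => //.
  move=> u v eS; rewrite eS in gS; rewrite eS /wtG.
  rewrite !(tripsum_fill yN gS) // !(les_fill _ _ yN gS) !(res_fill _ _ yN gS).
  rewrite /ddF /valF /daF /= !addn0 !addn1 /= .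
  case: ifP => _; last by rewrite !mul0r addr0.
  by rewrite !exprD !exprS; split; ring.
exact: sum_splits_pqint.
Qed.

Lemma sum_wtD n : (n < N)%N ->
  \sum_(T <- level n | N \notin T) wtD n T = wtD 0 [:: N] * motzkin n 1.
Proof.
apply: sum_level => y S k yN SL; have gS := level_gapword (ltnW yN) SL.
case aS : (andre y S); last first.
  (* Fillings of a word that is not Andre all have weight 0, so any [g] with sum [[m]] serves. *)
  apply: (@sum_fillings_motzkin _ _ _ _ (fun u v => q ^+ gaps u * p ^+ gaps v)) => //.
    move=> u v eS; rewrite /wtD aS; rewrite eS in gS aS.
    by rewrite !(andre_fill _ _ yN gS) aS !mul0r addr0.
  exact: sum_splits_pqint.
have dS := andre_subword aS.
apply: (@sum_fillings_motzkin _ _ _ _ (fun u v => if locked v then 0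
      else q ^+ (gaps u - unlocks u v) * (p + q) ^+ unlocks u v * p ^+ gaps v)) => //.
  2: exact: (sum_splits_unlocked yN gS dS).
have [_ _ /(_ aS) /andP[l1 l2]] := level_stats (ltnW yN) SL.
move=> u v eS; rewrite /wtD aS; rewrite eS in gS aS l1 l2 *.
rewrite !(andre_fill _ _ yN gS) aS /=; case hl : (locked v) => /=.
  by rewrite !mulr0 !mul0r addr0.
rewrite add0r.
have expE a b : (les (fill y.+1 (u, v) (a, b)) + locks (fill y.+1 (u, v) (a, b))
      - (tripsum valF 0 0 (u ++ N :: v) + (a && b))
    = (les (u ++ N :: v) + locks (u ++ N :: v) - tripsum valF 0 0 (u ++ N :: v))
      + (gaps u - unlocks u v))%N /\
    (tripsum valF 0 0 (u ++ N :: v) + (a && b) - locks (fill y.+1 (u, v) (a, b))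
    = (tripsum valF 0 0 (u ++ N :: v) - locks (u ++ N :: v)) + unlocks u v)%N.
  have := locks_fill a b yN gS (negbT hl); have := unlocks_le_gaps u v.
  (* A peak creates no lock, so this instance yields the bound of [unlocks u v] by the old number of
     locks. *)
  have := locks_fill false false yN gS (negbT hl).
  rewrite (les_fill _ _ yN gS); move: l1 l2.
  move: (locks _) (locks _) (locks _) (nat_of_bool (a && b)) (nat_of_bool _) (les _).
  move: (tripsum _ _ _ _) (gaps u); clear; lia.
rewrite !(tripsum_fill yN gS) // !(res_fill _ _ yN gS).
have vE a b : valF a b (~~ b) = a && b by [].
have dE a b : daF a b (~~ b) = ~~ a && b by [].
rewrite !vE !dE.
have [-> ->] := expE true true; have [-> ->] := expE false true.
have [-> ->] := expE false false; rewrite /= !addn0 !exprD; split; ring.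
Qed.

End Weights.

End GapWords.

(** * Permutations as completed gap words *)

Lemma word_permP n (w : seq nat) :
  reflect (exists s : 'S_n, w = word s) (perm_eq w (iota 1 n)).
Proof.
apply: (iffP idP) => [pw|[s ->]].
  have sw : size w = n by rewrite (perm_size pw) size_iota.
  have wi (i : 'I_n) : 0 < nth 0 w i <= n.
    have : nth 0 w i \in w by rewrite mem_nth // sw.
    by rewrite (perm_mem pw) mem_iota add1n ltnS.
  have lt_i (i : 'I_n) : (nth 0 w i).-1 < n by have := wi i; lia.
  have f_inj : injective (fun i => Ordinal (lt_i i)).
    move=> i j /(congr1 val) /= e; apply/val_inj/eqP => /=.
    have uw : uniq w by rewrite (perm_uniq pw) iota_uniq.
    rewrite -(nth_uniq 0 _ _ uw) ?sw //; apply/eqP.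
    have := wi i; have := wi j; move: e.
    by move: (nth 0 w i) (nth 0 w j); clear; lia.
  exists (perm f_inj); apply: (@eq_from_nth _ 0).
    by rewrite /word size_map size_enum_ord.
  move=> i; rewrite sw => lt_in; rewrite /word (nth_map (Ordinal lt_in)) ?size_enum_ord //.
  rewrite permE /= nth_enum_ord //.
  by have := wi (Ordinal lt_in); rewrite /=; lia.
apply: uniq_perm; rewrite ?iota_uniq //.
  rewrite map_inj_uniq ?enum_uniq // => i j [] /val_inj; exact: perm_inj.
move=> c; rewrite mem_iota add1n ltnS; apply/mapP/idP => [[i _ ->]|].
  exact: ltn_ord.
case: c => // c /= lt_cn; exists ((s^-1)%g (Ordinal lt_cn)); first by rewrite mem_enum.
by rewrite permKV.
Qed.

Lemma word_inj n : injective (@word n).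
Proof.
move=> s s' e; apply/permP => i; apply: val_inj.
have wE (r : 'S_n) : nth 0 (word r) i = (r i).+1.
  by rewrite /word (nth_map i) ?size_enum_ord // nth_ord_enum.
by have := wE s; rewrite e wE => -[].
Qed.

Lemma gapword_full n w :
  (gapword n.+1 n w && (n.+1 \notin w)) = perm_eq w (iota 1 n).
Proof.
have fE : n.+1 \notin w -> [seq c <- w | c != n.+1] = w.
  by move=> h; apply/all_filterP/allP => c cw; apply: contraNneq h => <-.
apply/andP/idP => [[/andP[pw _] h]|pw]; first by rewrite fE in pw.
have h : n.+1 \notin w by rewrite (perm_mem pw) mem_iota; lia.
split => //; rewrite /gapword fE // pw /=.
have : all (predC1 n.+1) w.
  by apply/allP => c cw; apply: contraNneq h => <-.
case: (w) => //= a l; elim: l a => //= b l IH a /and3P[an bn ln].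
by rewrite /nogap2 an /= IH // bn.
Qed.

(** Followed by the closing [0], the lower letter of a final descent would be a double descent;
    equality with the preceding letter is excluded by distinctness. *)
Lemma ends_with_ascent_no_dd w :
  w != [::] -> uniq w -> 0 \notin w -> tripsum ddF 0 0 w = 0 -> ends_with_ascent w.
Proof.
case/lastP: w => [|w c] // _; rewrite rcons_uniq => /andP[cw uw].
rewrite mem_rcons inE negb_or => /andP[c0 w0].
rewrite -cats1 tripsum_cat cats1 /= => /eqP; rewrite !addn_eq0 eqb0 => /and3P[_ h _].
rewrite /ends_with_ascent size_rcons /= !letter_rcons eqxx.
rewrite (ltn_eqF (ltnSn _)) letter_size.
have : last 0 w != c.
  case/lastP: w cw {uw w0 h} => [|w d]; first by move: c0; rewrite eq_sym eq_sym.
  by rewrite mem_rcons inE negb_or last_rcons => /andP[]; rewrite eq_sym.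
move: h; rewrite /ddF; lia.
Qed.

(** For a finished word the first condition of [andre] is the case [k = n] of the second, as
    [subword w n] is [w]. *)
Lemma is_andreE n w : 0 < n -> perm_eq w (iota 1 n) -> is_andre w = andre n w.
Proof.
move=> n0 pw; have sw : size w = n by rewrite (perm_size pw) size_iota.
have uw : uniq w by rewrite (perm_uniq pw) iota_uniq.
have w0 : 0 \notin w by rewrite (perm_mem pw) mem_iota.
have wn : subword w n = w.
  by apply/all_filterP/allP => c; rewrite (perm_mem pw) mem_iota add1n ltnS.
rewrite /is_andre /andre sw.
have -> : all (fun k => no_double_descent (subword w k) && ends_with_ascent (subword w k)) (iota 1 n)
   = all (fun k => tripsum ddF 0 0 (subword w k) == 0) (iota 1 n).
  apply: eq_in_all => k; rewrite mem_iota => hk; rewrite no_double_descentE.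
  apply: andb_idr => /eqP; apply: ends_with_ascent_no_dd.
  - rewrite -has_filter; apply/hasP; exists 1; last by lia.
    by rewrite (perm_mem pw) mem_iota; lia.
  - exact: filter_uniq.
  - by rewrite mem_filter.
symmetry; apply: andb_idl => /allP/(_ n); rewrite wn; apply.
by rewrite mem_iota; lia.
Qed.

Local Open Scope ring_scope.

Section Sums.

Variable R : comNzRingType.

Lemma sum_word n (f : seq nat -> R) : (0 < n)%N ->
  \sum_(s : 'S_n) f (word s) = \sum_(w <- level n.+1 n | n.+1 \notin w) f w.
Proof.
move=> n0; rewrite -[RHS]big_filter -big_enum -(big_map (@word n) xpredT f) /=.
apply: perm_big; apply: uniq_perm.
- by rewrite map_inj_uniq ?enum_uniq //; apply: word_inj.
- by apply: filter_uniq; apply: uniq_level.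
move=> w; rewrite mem_filter; apply/mapP/andP => [[s _ ew]|[nw wl]].
  have : perm_eq w (iota 1 n) by apply/word_permP; exists s.
  move=> pw; move: (pw); rewrite -gapword_full => /andP[gw nw]; split => //.
  by apply: mem_level => //; apply: contraTneq n0 => we; move/perm_size: pw; rewrite we size_iota => <-.
have : perm_eq w (iota 1 n).
  by rewrite -gapword_full nw andbT; apply: level_gapword wl.
by case/word_permP => s ->; exists s; rewrite ?mem_enum.
Qed.

(** The summand [c] depends on [k] because the exponent of q in [dpoly] does; on the class [v w = k]
    it becomes [c (v w) w]. *)
Lemma sum_by_stat (r : seq (seq nat)) (P b : pred (seq nat)) (v : seq nat -> nat)
    (c : nat -> seq nat -> R) (g : nat -> R) M :
  (forall w, w \in r -> P w -> b w -> v w < M)%N ->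
  \sum_(0 <= k < M) (\sum_(w <- r | P w) (if b w && (v w == k) then c k w else 0)) * g k
  = \sum_(w <- r | P w) (if b w then c (v w) w * g (v w) else 0).
Proof.
move=> vM; under eq_bigr do rewrite mulr_suml.
rewrite exchange_big /= big_seq_cond [RHS]big_seq_cond.
apply: eq_bigr => w /andP[wr Pw]; case bw : (b w) => /=; last first.
  by rewrite big1 // => k _; rewrite mul0r.
transitivity (\sum_(0 <= k < M | k == v w) c k w * g k).
  rewrite [RHS]big_mkcond; apply: eq_bigr => k _.
  by rewrite eq_sym; case: eqP; rewrite ?mul0r.
by rewrite big_nat1_eq vM.
Qed.

End Sums.

Theorem theorem1p5 (R : comNzRingType) (n : nat) (hn : (1 <= n)%N) (p q t : R) :
  Apoly n p q t =
    \sum_(0 <= k < ((n - 1) %/ 2).+1)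
      gamma n k p q * t ^+ k * (1 + t) ^+ (n - 1 - 2 * k)
  /\
  \sum_(0 <= k < ((n - 1) %/ 2).+1)
      gamma n k p q * t ^+ k * (1 + t) ^+ (n - 1 - 2 * k) =
    \sum_(0 <= k < ((n - 1) %/ 2).+1)
      (p + q) ^+ k * dpoly n k p q * t ^+ k * (1 + t) ^+ (n - 1 - 2 * k).
Proof.
have N0 : (0 < n.+1)%N by [].
(* Without gaps the count in [level_stats] bounds the number of valleys by (n-1)/2. Absent double
   descents, it makes n-1-2k the number of double ascents of a word with k valleys. *)
have stats w : w \in level n.+1 n -> n.+1 \notin w ->
    [/\ perm_eq w (iota 1 n), des w = (tripsum valF 0 0 w + tripsum ddF 0 0 w)%N,
        locks n.+1 w = 0%N
      & n = ((tripsum valF 0 0 w).*2.+1 + tripsum daF 0 0 w + tripsum ddF 0 0 w)%N].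
  move=> wl nw; have [h1 h2 _] := level_stats N0 (ltnSn n) wl.
  have gw := level_gapword N0 (ltnSn n) wl.
  split; first by rewrite -gapword_full gw.
  - by rewrite desE.
  - elim: (w) nw => //= c l IH; rewrite inE negb_or => /andP[cn /IH ->].
    by rewrite eq_sym (negbTE cn).
  - by rewrite -h2; move: nw; rewrite -has_pred1 has_count -leqNgt leqn0 => /eqP->; rewrite addn0.
have [r0 l0] : res [:: n.+1] = 0%N /\ les [:: n.+1] = 0%N.
  by rewrite /res /les !big_geq.
have AE : Apoly n p q t = motzkin p q t n 1.
  rewrite /Apoly (sum_word (fun w => p ^+ res w * q ^+ les w * t ^+ des w)) //.
  under eq_bigr do rewrite desE.
  by rewrite (sum_wtA N0 p q t (ltnSn n)) /wtA r0 l0 /= !mulr1 mul1r.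
have GE : \sum_(0 <= k < ((n - 1) %/ 2).+1)
      gamma n k p q * t ^+ k * (1 + t) ^+ (n - 1 - 2 * k) = motzkin p q t n 1.
  transitivity (\sum_(w <- level n.+1 n | n.+1 \notin w) wtG p q t w); last first.
    by rewrite (sum_wtG N0 p q t (ltnSn n)) /wtG r0 l0 /= !mulr1 mul1r.
  pose b w := tripsum ddF 0 0 w == 0%N.
  pose c (k : nat) w := p ^+ res w * q ^+ les w.
  pose g k := t ^+ k * (1 + t) ^+ (n - 1 - 2 * k).
  transitivity (\sum_(0 <= k < ((n - 1) %/ 2).+1)
     (\sum_(w <- level n.+1 n | n.+1 \notin w)
        (if b w && (tripsum valF 0 0 w == k) then c k w else 0)) * g k).
    apply: eq_bigr => k _; rewrite -mulrA; congr (_ * _).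
    rewrite -(sum_word (fun w => if b w && (tripsum valF 0 0 w == k) then c k w else 0)) //.
    rewrite /gamma big_mkcond; apply: eq_bigr => s _.
    by rewrite inE valleysE no_double_descentE andbC.
  rewrite (@sum_by_stat _ _ _ b) => [|w wl nw /eqP bw]; last first.
    by have [_ _ _] := stats w wl nw; rewrite bw; lia.
  rewrite big_seq_cond [RHS]big_seq_cond; apply: eq_bigr => w /andP[wl nw].
  rewrite /wtG /b; case: eqP => // bw; rewrite /c /g mulrA.
  congr (_ * _ ^+ _); have [_ _ _] := stats w wl nw; rewrite bw; lia.
have DE : \sum_(0 <= k < ((n - 1) %/ 2).+1)
      (p + q) ^+ k * dpoly n k p q * t ^+ k * (1 + t) ^+ (n - 1 - 2 * k)
    = motzkin p q t n 1.
  transitivity (\sum_(w <- level n.+1 n | n.+1 \notin w) wtD n.+1 p q t n w); last first.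
    by rewrite (sum_wtD N0 p q t (ltnSn n)) /wtD r0 l0 /andre /= eqxx !mulr1 mul1r.
  pose c k w := p ^+ res w * q ^+ (les w - k).
  pose g k := (p + q) ^+ k * t ^+ k * (1 + t) ^+ (n - 1 - 2 * k).
  transitivity (\sum_(0 <= k < ((n - 1) %/ 2).+1)
     (\sum_(w <- level n.+1 n | n.+1 \notin w)
        (if andre n w && (tripsum valF 0 0 w == k) then c k w else 0)) * g k).
    apply: eq_bigr => k _; rewrite /g [_ * dpoly _ _ _ _]mulrC -!mulrA; congr (_ * _).
    rewrite /dpoly big_mkcond.
    rewrite (eq_bigr (fun s : 'S_n => if is_andre (word s) && (des (word s) == k)
                then c k (word s) else 0)); last by move=> s _; rewrite inE.
    rewrite (sum_word (fun w => if is_andre w && (des w == k) then c k w else 0)) //.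
    rewrite big_seq_cond [RHS]big_seq_cond; apply: eq_bigr => w /andP[wl nw].
    have [pw -> _ _] := stats w wl nw; rewrite (is_andreE hn pw).
    (* An Andre word has no double descents, so its descents are counted by its valleys. *)
    by case aw : (andre n w) => //; case/andP: aw => /eqP-> _; rewrite addn0.
  rewrite (@sum_by_stat _ _ _ (andre n)) => [|w wl nw /andP[/eqP bw _]]; last first.
    by have [_ _ _] := stats w wl nw; rewrite bw; lia.
  rewrite big_seq_cond [RHS]big_seq_cond; apply: eq_bigr => w /andP[wl nw].
  rewrite /wtD; case: ifP => // /andP[/eqP bw _].
  (* A finished word has no lock left, so every valley has traded its factor q for p + q. *)
  have [_ _ lk nE] := stats w wl nw; rewrite lk addn0 subn0 /c /g !mulrA.
  congr (_ * _ ^+ _); move: nE; rewrite bw; lia.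
by rewrite AE GE DE.
Qed.
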